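(* Let $m \in \mathbb{N}_+$ and $\theta = 1/\sqrt{m}$ (so $\theta^2 = 1/m$). For every $\eta \geq 0$, the set \[ E(\eta) = \left\{ x \in \Omega : \lim_{n \to \infty} \frac{L_n(x)\, \log\log n}{n} = \eta \right\} \] has Hausdorff dimension $\dim_H(E(\eta)) = 1$.
   Context: Fix $m \in \mathbb{N}_+$ and $\theta$ with $\theta^2 = 1/m$. The map $T_\theta:[0,\theta]\to[0,\theta]$ is $T_\theta(x) = \frac{1}{x} - \theta\left\lfloor \frac{1}{x\theta}\right\rfloor$ for $x \in (0,\theta]$ and $T_\theta(0)=0$. For $x \ne 0$ put $a_1(x) = \lfloor 1/(x\theta) \rfloor$ (and $a_1(0)=\infty$), and $a_{n+1}(x) = a_1(T_\theta^n(x))$. These digits give the $\theta$-expansion $x = 1/(a_1\theta + 1/(a_2\theta + \cdots))$; for irrational $x$ the expansion is infinite and all digits satisfy $a_n(x) \geq m$. Let $\Omega = (0,\theta)\setminus\mathbb{Q}$, and for $x \in \Omega$ let $L_n(x) = \max_{1\le i\le n} a_i(x)$. *)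

(* Defs.v *)
From mathcomp Require Export all_boot all_order all_algebra.
From mathcomp Require Export all_classical all_reals all_analysis.
Export Order.TTheory GRing.Theory Num.Theory.
Export numFieldNormedType.Exports.

Set Implicit Arguments.
Unset Strict Implicit.
Unset Printing Implicit Defensive.

Local Open Scope classical_set_scope.
Local Open Scope ring_scope.

Section Hausdorff.
Context {R : realType}.
Implicit Types (A U : set R) (s delta : R).

(* For empty [A] this is the supremum of the empty set, namely [-oo]. *)
Definition diameter A : \bar R :=
  ereal_sup [set `|p.1 - p.2|%:E | p in A `*` A].

(* The empty set contributes 0 for every exponent, including [s = 0], whereas a
   singleton contributes [0 `^ 0 = 1] when [s = 0]. *)
Definition diameter_pow s U : \bar R :=
  if U == set0 then 0%E else poweR (diameter U) s.

Definition delta_cover delta A (U : nat -> set R) : Prop :=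
  A `<=` \bigcup_i U i /\ forall i, (diameter (U i) <= delta%:E)%E.

Definition hausdorff_premeasure s delta A : \bar R :=
  ereal_inf [set (\sum_(0 <= i <oo) diameter_pow s (U i))%E
            | U in delta_cover delta A].

(* The premeasure is nonincreasing in [delta], so the supremum is its limit as
   [delta] tends to 0. *)
Definition hausdorff_measure s A : \bar R :=
  ereal_sup [set hausdorff_premeasure s delta A | delta in [set d : R | 0 < d]].

Definition hausdorff_dim A : \bar R :=
  ereal_inf [set s%:E | s in [set s : R | 0 <= s /\ hausdorff_measure s A = 0%E]].

End Hausdorff.

Section ThetaExpansion.
Context {R : realType}.
Implicit Types (theta x : R) (n : nat).

Definition T_map theta x : R :=
  if x == 0 then 0 else x^-1 - theta * (Num.floor (x * theta)^-1)%:~R.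

Definition digit1 theta x : \bar R :=
  if x == 0 then +oo%E else ((Num.floor (x * theta)^-1)%:~R)%:E.

(* Digits are indexed from 1; [digit theta 0 x] is a junk value. *)
Definition digit theta n x : \bar R := digit1 theta (iter n.-1 (T_map theta) x).

Definition Omega theta : set R := `]0, theta[%classic `\` @rational R.

Definition max_digit theta n x : \bar R :=
  \big[maxe/-oo%E]_(1 <= i < n.+1) digit theta i x.

(* When [theta] is irrational, [Omega theta] contains countably many points
   with a finite expansion (such as [(k * theta)^-1]); these have [+oo] as a
   digit, which is why the limit is taken in the extended reals. *)
Definition E_set theta (eta : R) : set R :=
  [set x | Omega theta x /\
    (max_digit theta n x * (ln (ln n%:R) / n%:R)%:E)%E @[n --> \oo] --> eta%:E].

End ThetaExpansion.

(* Main.v *)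
Require Import Defs.
From mathcomp Require Import ring lra zify.

(* Words of digits are steered through a tree.  At a free level the next digit
   is any element of [m, m + k); since the cylinders of a word [w] partition it
   and each has at most half its length, the sum of their lengths to the power
   [s < 1] is at least [lam > 1] times that of [w], once [k] is large.  At a
   forced level the digit is about [eta * n / ln (ln n)], which loses only a
   polynomial factor in [n].  The exponential gain of the free levels therefore
   pays for forced levels at a density for which consecutive ones have ratio
   tending to 1, so that every branch has the required maximal digits.

   If a cover of the set had too small an [s]-sum, then at each word one could
   pass to a child [w'] such that the sum of the weights of the sets meeting [w']
   stays below the mass of [w']: a set of weight below the mass of [w] is shorter
   than the gaps between the children of [w], so it meets only one of them.  The
   branch obtained in this way is a point that is not covered.  No measure on the
   limit set is needed, and the countably many rationals are avoided by adding
   them to the cover as singletons. *)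

Local Open Scope classical_set_scope.
Local Open Scope ring_scope.

(* Words are stored last digit first. *)
Fixpoint rprefix (a : nat -> nat) n : seq nat :=
  if n is n'.+1 then a n' :: rprefix a n' else [::].

(** * Branches of a tree that avoid sets of small total weight *)

Section TreeAvoidance.
Set Implicit Arguments.
Unset Strict Implicit.
Context {R : realType} (A : nat -> seq nat) (A_uniq : forall n, uniq (A n)).

Fixpoint tree_word (w : seq nat) : bool :=
  if w is a :: w' then (a \in A (size w')) && tree_word w' else true.

Context (nu : seq nat -> R) (hits : nat -> seq nat -> bool) (u : nat -> R).
Context (u_ge0 : forall i, 0 <= u i).
Context (hits_cons : forall i a w, hits i (a :: w) -> hits i w).
Context (nu_le : forall w, tree_word w ->
  nu w <= \sum_(a <- A (size w)) nu (a :: w)).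
Context (hits_inj : forall i w a b, tree_word w -> u i < nu w ->
  a \in A (size w) -> b \in A (size w) ->
  hits i (a :: w) -> hits i (b :: w) -> a = b).

Let load w : \bar R := (\sum_(0 <= i <oo) (u i * (hits i w)%:R)%:E)%E.

Let load_term_ge0 i w : (0 <= (u i * (hits i w)%:R)%:E)%E.
Proof. by rewrite lee_fin mulr_ge0. Qed.

Let le_load i w : hits i w -> ((u i)%:E <= load w)%E.
Proof.
move=> hiw; rewrite /load (@nneseriesD1 _ _ i)//= hiw mulr1.
by rewrite leeDl// nneseries_ge0// => n _ _; exact: load_term_ge0.
Qed.

(** If every child had load at least its mass, the child loads would sum to at least [nu w]. But no
    set that hits [w] can hit two children, so they sum to at most [load w]. *)
Let load_step w : tree_word w -> (load w < (nu w)%:E)%E ->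
  exists2 a, a \in A (size w) & (load (a :: w) < (nu (a :: w))%:E)%E.
Proof.
move=> tw lw; apply: contrapT => H.
have Hle a : a \in A (size w) -> ((nu (a :: w))%:E <= load (a :: w))%E.
  by move=> aA; rewrite leNgt; apply/negP => la; apply: H; exists a.
suff : ((nu w)%:E <= load w)%E by rewrite leNgt lw.
apply: (@le_trans _ _ (\sum_(a <- A (size w)) load (a :: w))%E).
  rewrite (le_trans (y := (\sum_(a <- A (size w)) nu (a :: w))%:E))//.
    by rewrite lee_fin nu_le.
  rewrite -sumEFin big_seq [leRHS]big_seq; apply: lee_sum => a; exact: Hle.
rewrite /load -nneseries_sum; last by move=> a i _; exact: load_term_ge0.
apply: lee_nneseries => [i _ _|i _].
  by apply: sume_ge0 => a _; exact: load_term_ge0.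
rewrite sumEFin lee_fin -mulr_sumr; apply: ler_wpM2l => //.
have [hiw|/negP hiw] := boolP (hits i w); last first.
  by rewrite big1// => a _; have [/hits_cons//|//] := boolP (hits i (a :: w)).
(* A set hitting [w] counts fully in [load w], so it is light enough for [hits_inj]. *)
have ui : u i < nu w by rewrite -lte_fin (le_lt_trans _ lw)// le_load.
have [/hasP[b bA hb]|/hasPn no] := boolP (has (fun a => hits i (a :: w)) (A (size w))).
  rewrite (bigD1_seq b)//= hb big_seq_cond big1 ?addr0// => a /andP[aA ab].
  case: (boolP (hits i (a :: w))) => // ha.
  by rewrite (hits_inj tw ui aA bA ha hb) eqxx in ab.
by rewrite big_seq big1// => a /no/negbTE ->.
Qed.

(** The invariant [load < nu] holds at the root, where the load is at most the total weight, and
    [load_step] hands it on to some child. A set hitting a word weighs at most the load of that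
    word. *)
Lemma tree_avoidance : (\sum_(0 <= i <oo) (u i)%:E < (nu [::])%:E)%E ->
  exists2 c : nat -> nat, forall n, c n \in A n &
    forall n i, hits i (rprefix c n) -> u i < nu (rprefix c n).
Proof.
move=> u_lt.
have /choice[f fP] w : exists a, tree_word w -> (load w < (nu w)%:E)%E ->
    a \in A (size w) /\ (load (a :: w) < (nu (a :: w))%:E)%E.
  have [[tw lw]|no] := pselect (tree_word w /\ (load w < (nu w)%:E)%E).
    by have [a aA la] := load_step tw lw; exists a.
  by exists 0%N => tw lw; case: no.
pose word n := iter n (fun w => f w :: w) [::].
pose c n := f (word n).
have wordE n : rprefix c n = word n by elim: n => //= n ->.
have size_word n : size (word n) = n by elim: n => //= n ->.
have wordP n : tree_word (word n) /\ (load (word n) < (nu (word n))%:E)%E.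
  elim: n => [|n [tw lw]] /=.
    split=> //; apply: le_lt_trans u_lt; apply: lee_nneseries => [i _ _|i _].
      exact: load_term_ge0.
    by rewrite lee_fin ler_piMr// lern1; case: (hits _ _).
  by have [fA lf] := fP _ tw lw; rewrite fA tw.
exists c => [n|n i]; rewrite ?wordE; have [tw lw] := wordP n.
  by have [+ _] := fP _ tw lw; rewrite size_word.
by move=> hi; rewrite -lte_fin (le_lt_trans _ lw)// le_load.
Qed.

End TreeAvoidance.

(** * Weights that decide which levels are forced *)

Section GrowthWeights.
Set Implicit Arguments.
Unset Strict Implicit.
Context {R : realType}.
Implicit Types (lam K eps : R).

Lemma poly_le_expn lam K : 1 < lam ->
  exists t0, forall t, (t0 <= t)%N -> K * t.+1%:R ^+ 2 <= lam ^+ t.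
Proof.
move=> lam1; have l0 : 0 < ln lam by exact: ln_gt0.
have l3 : 0 < ln lam ^+ 3 by rewrite exprn_gt0.
have [K0|K0] := leP K 0.
  exists 0%N => t _; apply: (@le_trans _ _ 0); first by rewrite mulr_le0_ge0// sqr_ge0.
  by rewrite exprn_ge0//; lra.
(* The cubic term of the exponential series wins; 24 is 4 times [3!], the 4 coming from
   [(t + 1)^2 <= 4 t^2]. *)
exists (Num.truncn (24 * K / ln lam ^+ 3)).+1 => t tN.
have {}tN : 24 * K / ln lam ^+ 3 <= t%:R.
  by apply/ltW; apply: (lt_le_trans (truncnS_gt _)); rewrite ler_nat.
have t1 : 1 <= t%:R :> R.
  rewrite ler1n lt0n; apply/eqP => t0; move: tN; rewrite t0 leNgt divr_gt0//.
  by rewrite mulr_gt0.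
rewrite ler_pdivrMr// in tN.
have -> : lam ^+ t = expR (t%:R * ln lam).
  by rewrite expRM_natl lnK// posrE; lra.
have x0 : 0 <= t%:R * ln lam by rewrite mulr_ge0// ltW.
apply: (le_trans _ (expR_ge1Dxn 2 x0)).
have -> : 3`!%:R = 6 :> R by [].
rewrite exprMn -natr1.
have t2 : 1 <= t%:R ^+ 2 :> R by rewrite expr2; nra.
have : 24 * K * t%:R ^+ 2 <= t%:R * ln lam ^+ 3 * t%:R ^+ 2.
  by rewrite ler_wpM2r// sqr_ge0.
have -> : t%:R * ln lam ^+ 3 * t%:R ^+ 2 = t%:R ^+ 3 * ln lam ^+ 3 by ring.
move: (t%:R ^+ 3 * _) => X.
have : K * (t%:R + 1) ^+ 2 <= K * (4 * t%:R ^+ 2).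
  by rewrite ler_pM2l// !expr2; nra.
by lra.
Qed.

(* The weight decays by [lam] at each free level and a level becomes forced as
   soon as resetting the weight to 1 pays for a loss of [C * n ^ 2]. *)
Fixpoint weight lam C (n : nat) : R :=
  if n is n'.+1 then
    if C * n'.+1%:R ^+ 2 * weight lam C n' <= 1 then 1 else weight lam C n' / lam
  else 1.

Definition forced lam C n := C * n.+1%:R ^+ 2 * weight lam C n <= 1.

Lemma weightS lam C n :
  weight lam C n.+1 = if forced lam C n then 1 else weight lam C n / lam.
Proof. by []. Qed.

Lemma weight_bounds lam C n : 1 < lam -> 0 < weight lam C n <= 1.
Proof.
move=> lam1; have lam0 : 0 < lam by lra.
elim: n => [|n /andP[w0 w1]]; first by rewrite /= ltr01 lexx.
rewrite weightS; case: ifP => _; first by rewrite ltr01 lexx.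
rewrite divr_gt0//= ler_pdivrMr//; lra.
Qed.

(** If the last [t + 1] levels below [n], with [t] the integer part of [eps n], were all free, the
    weight at level [n - 1] would be at most [lam^-t], small enough to make that level forced. *)
Lemma forced_dense lam C eps : 1 < lam -> 0 <= C -> 0 < eps < 1 ->
  exists N, forall n, (N <= n)%N ->
    exists i, [/\ forced lam C i, (i < n)%N & (1 - eps) * n%:R <= i.+1%:R].
Proof.
move=> lam1 C0 /andP[eps0 eps1]; have lam0 : 0 < lam by lra.
(* The factor [1 / eps^2] is there because [eps n < t + 1] gives [n^2 <= (t + 1)^2 / eps^2]. *)
have [t0 t0P] := poly_le_expn (C / eps ^+ 2) lam1.
exists (maxn (Num.truncn (t0%:R / eps)).+1 1) => n; rewrite geq_max => /andP[nN n1].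
have n0R : 0 < n%:R :> R by rewrite ltr0n.
pose t := Num.truncn (eps * n%:R).
have en0 : 0 <= eps * n%:R by rewrite mulr_ge0// ltW.
have tle : t%:R <= eps * n%:R by rewrite /t truncn_le.
have tgt : eps * n%:R < t.+1%:R by exact: truncnS_gt.
have t0t : (t0 <= t)%N.
  rewrite -ltnS -(ltr_nat R); apply: le_lt_trans tgt.
  rewrite mulrC -ler_pdivrMr//; apply/ltW.
  by apply: (lt_le_trans (truncnS_gt _)); rewrite ler_nat.
have tn : (t < n)%N.
  rewrite -(ltr_nat R) (le_lt_trans tle)// -[ltRHS]mul1r ltr_pM2r//.
apply: contrapT => no.
have nf i : (n - t.+1 <= i)%N -> (i < n)%N -> ~~ forced lam C i.
  move=> hi ltin; apply/negP => fi; apply: no; exists i; split=> //.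
  have : (n <= i.+1 + t)%N by lia.
  by rewrite -(ler_nat R) natrD; lra.
have decay j : (j <= t)%N -> weight lam C (n - t.+1 + j) <= lam ^- j.
  elim: j => [|j IH] jt.
    by rewrite addn0 expr0 invr1; have /andP[] := weight_bounds C (n - t.+1) lam1.
  rewrite addnS weightS (negbTE (nf _ _ _)); [|lia..].
  by rewrite exprSr invfM ler_pM2r ?invr_gt0// IH// ltnW.
have := nf n.-1; rewrite /forced prednK// => /(_ _ _)/negP; apply; [lia..|].
have -> : n.-1 = (n - t.+1 + t)%N by lia.
apply: (@le_trans _ _ (C * n%:R ^+ 2 * lam ^- t)).
  by rewrite ler_wpM2l ?decay// mulr_ge0// sqr_ge0.
rewrite ler_pdivrMr ?exprn_gt0// mul1r; apply: le_trans (t0P _ t0t).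
rewrite -mulrA ler_wpM2l// mulrC ler_pdivlMr ?exprn_gt0// -exprMn.
by rewrite ler_sqr ?nnegrE// 1?mulrC// ?(ltW tgt)// mulr_ge0// ltW.
Qed.

End GrowthWeights.

(** * The sequence [n / log log n] and the forced digits *)

Section LogLog.
Set Implicit Arguments.
Unset Strict Implicit.
Context {R : realType}.
Implicit Types x y eps : R.

Lemma loglog_ge1 x : 1 <= ln (ln x) -> 1 < x /\ 1 < ln x.
Proof.
move=> lx; have l1 : 1 < ln x.
  by rewrite ltNge; apply/negP => /ln_le0; lra.
by split=> //; rewrite ltNge; apply/negP => /ln_le0; lra.
Qed.

(** The inequality [ln (1 + z) <= z], used twice, bounds the increment of [ln ln] by [(y - x) / x];
    then [ln (ln x) >= 1] suffices. *)
Lemma le_div_loglog x y : 1 <= ln (ln x) -> x <= y ->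
  x / ln (ln x) <= y / ln (ln y).
Proof.
move=> lx xy; have [x1 l1] := loglog_ge1 lx.
have x0 : 0 < x by lra.
have y0 : 0 < y by lra.
have lxy : ln x <= ln y by rewrite ler_ln.
have llxy : ln (ln x) <= ln (ln y) by rewrite ler_ln ?posrE//; lra.
have hxy : ln y - ln x <= y / x - 1.
  rewrite -ln_div// -[y / x in leLHS](subrKC 1); apply: le_ln1Dx.
  by have := divr_gt0 y0 x0; lra.
have hll : ln (ln y) - ln (ln x) <= ln y / ln x - 1.
  rewrite -ln_div ?posrE//; [|lra..]; rewrite -[_ / _ in leLHS](subrKC 1); apply: le_ln1Dx.
  by have : 0 < ln y / ln x; [rewrite divr_gt0//; lra|lra].
have h1 : ln y / ln x - 1 <= ln y - ln x.
  have -> : ln y / ln x - 1 = (ln y - ln x) / ln x by field; lra.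
  by rewrite ler_pdivrMr; [rewrite ler_peMr|]; lra.
have h2 : ln (ln y) - ln (ln x) <= (y - x) / x.
  have -> : (y - x) / x = y / x - 1 by field; lra.
  by lra.
rewrite ler_pdivlMr in h2 => //.
rewrite ler_pdivrMr; last lra.
rewrite mulrAC ler_pdivlMr; last lra.
nra.
Qed.

Lemma loglog_small eps : 0 < eps -> \forall n \near \oo, ln (ln n%:R) <= eps * n%:R.
Proof.
move=> e0; have e2 : 0 < eps / 2 by lra.
near=> n.
have n1 : 1 < n%:R :> R by near: n; exact: nbhs_infty_gtr.
have nB : - ln (eps / 2) / (eps / 2) <= n%:R by near: n; exact: nbhs_infty_ger.
have ln0 : 0 < ln n%:R :> R by exact: ln_gt0.
apply: (le_trans (ltW (ln_sublinear ln0))).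
have -> : n%:R = (eps / 2 * n%:R) / (eps / 2) :> R by field; lra.
rewrite ler_pdivrMr// in nB.
have en : 0 < eps / 2 * n%:R by rewrite mulr_gt0//; lra.
rewrite ln_div ?posrE//.
have := ln_sublinear en.
have -> : eps * (eps / 2 * n%:R / (eps / 2)) = 2 * (eps / 2 * n%:R) by field; lra.
lra.
Unshelve. all: by end_near. Qed.

(** Positions count from 0, hence [n.+1]. Adding [m] keeps the digit admissible and, for [m > 0],
    outweighs the truncation. The test leaves out small [n], where the quotient need not be positive
    or monotone. *)
Definition big_digit (eta : R) (m n : nat) : nat := addn m
  (if 1 <= ln (ln n.+1%:R) :> R then Num.truncn (eta * (n.+1%:R / ln (ln n.+1%:R)))
   else 0%N).

(** A forced digit [b] shortens a cylinder by at most the factor [b.+2 ^+ 2], so the loss is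
    quadratic in the position. *)
Lemma big_digit_le_linear (eta : R) m n : 0 <= eta ->
  (big_digit eta m n).+2%:R ^+ 2 <= (m%:R + 2 + eta) ^+ 2 * n.+1%:R ^+ 2.
Proof.
move=> eta0.
have : 0 <= (m%:R + 2 + eta) * n.+1%:R by rewrite mulr_ge0// !addr_ge0.
move=> P0; rewrite -exprMn; apply: lerXn2r; rewrite ?nnegrE//.
have n1 : 1 <= n.+1%:R :> R by rewrite ler1n.
have m0 : 0 <= m%:R :> R by [].
have h : (if 1 <= ln (ln n.+1%:R) :> R then
    Num.truncn (eta * (n.+1%:R / ln (ln n.+1%:R))) else 0%N)%:R <= eta * n.+1%:R.
  case: ifP => [ll|_]; last by rewrite mulr_ge0.
  apply: (@le_trans _ _ (eta * (n.+1%:R / ln (ln n.+1%:R)))).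
    by rewrite truncn_le// mulr_ge0// divr_ge0//; lra.
  rewrite ler_wpM2l// ler_pdivrMr; last lra.
  by rewrite ler_peMr//; lra.
by rewrite /big_digit -addn2 !natrD; nra.
Qed.

Lemma big_digit_le (eta : R) m i n : 0 <= eta -> (i < n)%N -> 0 < ln (ln n%:R) :> R ->
  (big_digit eta m i)%:R <= m%:R + eta * (n%:R / ln (ln n%:R)).
Proof.
move=> eta0 ltin ln0; rewrite /big_digit natrD lerD2l; case: ifP => [ll|_]; last first.
  by rewrite mulr_ge0// divr_ge0// ltW.
apply: (@le_trans _ _ (eta * (i.+1%:R / ln (ln i.+1%:R)))).
  by rewrite truncn_le// mulr_ge0// divr_ge0//; lra.
by rewrite ler_wpM2l// le_div_loglog// ler_nat.
Qed.

Lemma big_digit_ge (eta : R) m i : (0 < m)%N -> 1 <= ln (ln i.+1%:R) :> R ->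
  eta * (i.+1%:R / ln (ln i.+1%:R)) <= (big_digit eta m i)%:R.
Proof.
move=> m0 ll; rewrite /big_digit ll; apply/ltW; apply: (lt_le_trans (truncnS_gt _)).
by rewrite ler_nat -add1n leq_add2r.
Qed.

End LogLog.

(** * Null sets of Hausdorff measures and their covers *)

Section HausdorffBasics.
Set Implicit Arguments.
Unset Strict Implicit.
Context {R : realType}.
Implicit Types (A U : set R) (s d delta : R).

Lemma diameter_real U d : U !=set0 -> (diameter U <= d%:E)%E ->
  exists r, [/\ diameter U = r%:E, 0 <= r <= d &
    forall x y, U x -> U y -> `|x - y| <= r].
Proof.
move=> [x0 Ux0] Ud.
have ub x y : U x -> U y -> (`|x - y|%:E <= diameter U)%E.
  by move=> Ux Uy; apply: ereal_sup_ubound; exists (x, y).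
have := ub _ _ Ux0 Ux0; rewrite subrr normr0.
case: (diameter U) Ud ub => [r|//|//] rd ub r0.
exists r; split; first by [].
  by rewrite -!lee_fin r0 rd.
by move=> x y Ux Uy; rewrite -lee_fin ub.
Qed.

Lemma diameter_pow_ge0 s U : (0 <= diameter_pow s U)%E.
Proof. by rewrite /diameter_pow; case: ifP => // _; exact: poweR_ge0. Qed.

Lemma diameter_pow_le s U d : 0 <= s -> 0 <= d -> (diameter U <= d%:E)%E ->
  (diameter_pow s U <= (d `^ s)%:E)%E.
Proof.
move=> s0 d0 Ud; rewrite /diameter_pow; case: ifPn => [_|/set0P U0].
  by rewrite lee_fin powR_ge0.
have [r [-> /andP[r0 rd] _]] := diameter_real U0 Ud.
by rewrite poweR_EFin lee_fin ge0_ler_powR.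
Qed.

Lemma hausdorff_measure_eq0 s A : (forall delta eps : R, 0 < delta -> 0 < eps ->
  (hausdorff_premeasure s delta A <= eps%:E)%E) -> hausdorff_measure s A = 0%E.
Proof.
move=> H; apply/eqP; rewrite eq_le; apply/andP; split.
  apply: ge_ereal_sup => _ [delta /= d0 <-].
  by apply/lee_addgt0Pr => eps e0; rewrite add0e H.
apply: (@le_trans _ _ (hausdorff_premeasure s 1 A)); last first.
  by apply: ereal_sup_ubound; exists 1 => /=.
apply: le_ereal_inf_tmp => _ [U _ <-].
by apply: nneseries_ge0 => i _ _; exact: diameter_pow_ge0.
Qed.

(** [N] intervals of length [1 / N] have [s]-sum [N^(1 - s)], which tends to 0. *)
Lemma hausdorff_measure_unit_itv s A : 1 < s -> A `<=` `[0, 1]%classic ->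
  hausdorff_measure s A = 0%E.
Proof.
move=> s1 A01; apply: hausdorff_measure_eq0 => delta eps d0 e0.
have s0 : 0 <= s by lra.
(* Both the mesh [r <= delta] and the sum [r^(s - 1) <= eps] are secured. *)
pose r := Num.min delta (eps `^ (s - 1)^-1).
have r0 : 0 < r by rewrite lt_min d0 powR_gt0.
pose N := (Num.truncn r^-1).+1.
have N0 : 0 < N%:R :> R by rewrite ltr0n.
have Nr : N%:R^-1 <= r.
  by rewrite -[leRHS]invrK lef_pV2 ?posrE ?invr_gt0//; exact/ltW/truncnS_gt.
pose U i := [set x : R | (i < N)%N /\ i%:R / N%:R <= x <= i.+1%:R / N%:R].
have diamU i : (diameter (U i) <= N%:R^-1%:E)%E.
  apply: ge_ereal_sup => _ [[x y] /= [[_ /andP[x1 x2]] [_ /andP[y1 y2]]] <-].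
  rewrite lee_fin.
  have : i.+1%:R / N%:R = i%:R / N%:R + N%:R^-1 :> R by rewrite -natr1 mulrDl mul1r.
  by rewrite ler_norml => h; lra.
apply: (@le_trans _ _ (\sum_(0 <= i <oo) diameter_pow s (U i))%E).
  apply: ereal_inf_lbound; exists U => //; split=> [x /A01|i].
    rewrite /= in_itv /= => /andP[x0 x1].
    (* The point 1 goes to the last interval: truncating [x * N] would give the index [N], whose set
       is empty. *)
    have [x1'|x1'] := eqVneq x 1.
      exists N.-1 => //; split; first by rewrite prednK.
      rewrite x1' prednK// divff ?gt_eqF// lexx andbT ler_pdivrMr// mul1r.
      by rewrite ler_nat leq_pred.
    exists (Num.truncn (x * N%:R)) => //; split.
      rewrite -(ltr_nat R); apply: (@le_lt_trans _ _ (x * N%:R)).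
        by rewrite truncn_le// mulr_ge0// ltW.
      by rewrite -[ltRHS]mul1r ltr_pM2r// lt_neqAle x1'.
    rewrite ler_pdivrMr// truncn_le ?mulr_ge0// ?(ltW N0)//=.
    by rewrite ler_pdivlMr//; exact/ltW/truncnS_gt.
  by rewrite (le_trans (diamU i))// lee_fin (le_trans Nr)// ge_min lexx.
rewrite (nneseries_split _ N); last by move=> i _; exact: diameter_pow_ge0.
rewrite [X in (_ + X)%E]eseries0 ?adde0; last first.
  move=> i; rewrite add0n => Ni _; rewrite /diameter_pow ifT//; apply/eqP.
  by rewrite -subset0 => x [/=]; rewrite ltnNge Ni.
apply: (@le_trans _ _ (\sum_(0 <= i < 0 + N) (N%:R^-1 `^ s)%:E)%E).
  by apply: lee_sum => i _; apply: diameter_pow_le => //; rewrite invr_ge0 ltW.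
rewrite sumEFin lee_fin sumr_const_nat add0n subn0 -[leLHS]mulr_natr mulrC.
have Ni0 : 0 <= N%:R^-1 :> R by rewrite invr_ge0 ltW.
have s00 : 0 < s by lra.
rewrite -(mulr_powRB1 Ni0 s00) mulrA divff ?gt_eqF// mul1r.
apply: (@le_trans _ _ (r `^ (s - 1))).
  by apply: ge0_ler_powR; rewrite ?nnegrE ?(ltW r0)// subr_ge0 ltW.
have -> : eps = (eps `^ (s - 1)^-1) `^ (s - 1).
  by rewrite -powRrM mulVf ?powRr1 ?(ltW e0)// gt_eqF// subr_gt0.
by apply: ge0_ler_powR; rewrite ?nnegrE ?(ltW r0) ?powR_ge0 ?subr_ge0 ?(ltW s1)// ge_min lexx orbT.
Qed.

(* Interleaving with the singletons of the rationals costs only the [eps] that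
   also makes every weight positive. *)
Lemma null_cover_rational s t A eps : 0 <= s <= t -> 0 < t ->
  hausdorff_measure s A = 0%E -> 0 < eps ->
  exists (V : nat -> set R) (u : nat -> R), [/\ forall i, 0 < u i,
    forall i x y, V i x -> V i y -> `|x - y| `^ t <= u i,
    (\sum_(0 <= i <oo) (u i)%:E < eps%:E)%E &
    A `|` rational `<=` \bigcup_i V i].
Proof.
move=> /andP[s0 st] t0 mA e0.
have [S [U [AU U1] <-] Ueps] : exists2 S,
    [set (\sum_(0 <= i <oo) diameter_pow s (U i))%E | U in delta_cover 1 A] S &
    (S < (eps / 2)%:E)%E.
  apply: ereal_inf_lt; apply: (@le_lt_trans _ _ 0%E); last by rewrite lte_fin; lra.
  by rewrite -[leRHS]mA; apply: ereal_sup_ubound; exists 1 => //=.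
pose d j := fine (diameter_pow s (U j)).
have dE j : (d j)%:E = diameter_pow s (U j).
  rewrite fineK// ge0_fin_numE ?diameter_pow_ge0//.
  by rewrite (le_lt_trans (diameter_pow_le s0 ler01 (U1 j)))// ltry.
have d0 j : 0 <= d j by rewrite -lee_fin dE diameter_pow_ge0.
(* Distances in [U j] are at most 1, so raising the exponent from [s] to [t] lowers the power. For
   equal points, [t > 0] makes the power 0. *)
have Ud j x y : U j x -> U j y -> `|x - y| `^ t <= d j.
  move=> Ux Uy; have [->|xy] := eqVneq x y.
    by rewrite subrr normr0 powR0// gt_eqF.
  have U0 : U j !=set0 by exists x.
  have [r [rE /andP[r0 r1] rP]] := diameter_real U0 (U1 j).
  have -> : d j = r `^ s.
    by rewrite /d /diameter_pow rE poweR_EFin ifF//; apply/negbTE/set0P.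
  apply: (@le_trans _ _ (`|x - y| `^ s)).
    by rewrite ger_powR// normr_gt0 subr_eq0 xy (le_trans (rP _ _ Ux Uy)).
  by rewrite ge0_ler_powR// rP.
pose q j : R := if unpickle j is Some p then ratr (p : rat) else 0.
pose V i := if odd i then [set q i./2] else U i./2.
pose h i := if odd i then 0 else d i./2.
pose u i : R := h i + eps / 2 / (2 ^ i.+1)%:R.
have h0 i : 0 <= h i by rewrite /h; case: ifP.
exists V, u; split.
- by move=> i; rewrite ltr_wpDl// !divr_gt0// ltr0n expn_gt0.
- move=> i x y Vx Vy; apply: (@le_trans _ _ (h i)); last first.
    by rewrite lerDl !divr_ge0// ltW.
  move: Vx Vy; rewrite /V /h; case: ifP => _; last exact: Ud.
  by move=> -> ->; rewrite subrr normr0 powR0// gt_eqF.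
- rewrite /u; under eq_eseriesr do rewrite EFinD.
  rewrite nneseriesD => [|i _ _|i _ _]; rewrite ?lee_fin//; last first.
    by rewrite !divr_ge0// ltW.
  have -> : eps%:E = ((eps / 2)%:E + (eps / 2)%:E)%E by rewrite -EFinD; congr (_%:E); lra.
  rewrite -(lteD2rE (x := (eps / 2)%:E)) // in Ueps.
  apply: le_lt_trans Ueps; apply: leeD; last by apply: epsilon_trick0; lra.
  apply: lime_le.
    by apply: is_cvg_nneseries => i _ _; rewrite lee_fin.
  apply: nearW => n.
  (* Only even indices carry a term of [d], and [uphalf n] of them lie below [n]. *)
  have hsum : \sum_(0 <= i < n) h i = \sum_(0 <= j < uphalf n) d j.
    elim: n => [|n IH]; first by rewrite !big_geq.
    rewrite big_nat_recr//= IH /h uphalf_half; case: (boolP (odd n)) => on.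
      by rewrite addr0 add1n.
    by rewrite add0n big_nat_recr.
  rewrite sumEFin hsum -sumEFin; under eq_bigr do rewrite dE.
  by apply: nneseries_lim_ge => i _ _; exact: diameter_pow_ge0.
- move=> x [/AU[j _ Ujx]|[p _ <-]].
    by exists j.*2 => //; rewrite /V odd_double doubleK.
  exists (pickle p).*2.+1 => //; rewrite /V /= odd_double /= uphalf_double.
  by rewrite /q pickleK.
Qed.

End HausdorffBasics.

(** * Inverse branches, continuants and cylinder lengths *)

Section Branches.
Set Implicit Arguments.
Unset Strict Implicit.
Context {R : realType} (m : nat) (theta : R).
Context (m_gt0 : (0 < m)%N) (theta_gt0 : 0 < theta).
Context (theta2 : m%:R * theta ^+ 2 = 1).
Implicit Types (w : seq nat) (y z : R) (a b k n : nat).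

(** The continued fraction whose digits are [w] read from its far end and whose tail is [y], that
    is, an inverse branch of an iterate of [T_map]. *)
Fixpoint branch w y : R :=
  if w is a :: w' then branch w' (a%:R * theta + y)^-1 else y.

(* The last two continuants, i.e. the denominators of the Moebius map [branch w]. *)
Fixpoint denoms w : R * R :=
  if w is a :: w' then
    (a%:R * theta * (denoms w').1 + (denoms w').2, (denoms w').1)
  else (1, 0).

(** The length of the image of [[0, theta]] under [branch w]. *)
Definition cyl_len w : R :=
  theta / ((denoms w).1 * ((denoms w).1 + theta * (denoms w).2)).

Lemma mR_ge1 : 1 <= m%:R :> R.
Proof. by rewrite ler1n. Qed.

Lemma theta_le1 : theta <= 1.
Proof. have := mR_ge1; have := theta2; have := theta_gt0; nra. Qed.

Lemma theta_inv : theta^-1 = m%:R * theta.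
Proof.
by apply: (mulIf (lt0r_neq0 theta_gt0)); rewrite mulVf ?gt_eqF// -mulrA -expr2.
Qed.

Lemma digit_ge a : (m <= a)%N -> theta^-1 <= a%:R * theta.
Proof. by move=> ma; rewrite theta_inv ler_pM2r// ler_nat. Qed.

(** Since [m theta^2 = 1], a digit [a >= m] multiplies the last continuant by at least
    [1 / theta]. *)
Lemma denomsP w : all (leq m) w ->
  [/\ 0 < (denoms w).1, 0 <= (denoms w).2 & (denoms w).2 <= theta * (denoms w).1].
Proof.
elim: w => [_|a w IH] /=; first by split=> //; rewrite mulr1 ltW.
move=> /andP[ma /IH[]]; set q := (denoms w).1; set q' := (denoms w).2 => q0 q'0 _.
have amR : m%:R <= a%:R :> R by rewrite ler_nat.
have t0 := theta_gt0; have t2 := theta2; have m1 := mR_ge1.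
have tq : 0 < theta * q by rewrite mulr_gt0.
have aq : m%:R * (theta * q) <= a%:R * (theta * q) by rewrite ler_pM2r.
split; first nra.
- exact: ltW.
- have qE : q = theta * (m%:R * (theta * q)).
    by rewrite -[LHS](mul1r q) -[X in X * q]theta2; ring.
  rewrite {1}qE ler_pM2l//; nra.
Qed.

Lemma branch_ge0 w y : 0 <= y -> 0 <= branch w y.
Proof.
elim: w y => //= a w IH y y0; apply: IH.
by rewrite invr_ge0 addr_ge0// mulr_ge0// ltW.
Qed.

(** This is the distance formula of a Moebius map of determinant 1 or -1; the induction on [w]
    avoids the numerators. *)
Lemma branch_dist w y z : all (leq m) w -> 0 <= y -> 0 <= z ->
  `|branch w y - branch w z| =
  `|y - z| / (((denoms w).1 + y * (denoms w).2) *
              ((denoms w).1 + z * (denoms w).2)).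
Proof.
elim: w y z => [|a w IH] y z /=; first by rewrite !mulr0 !addr0 mulr1 divr1.
move=> /andP[ma wm] y0 z0; have [q0 q'0 _] := denomsP wm.
have at0 : 0 < a%:R * theta by rewrite mulr_gt0// ltr0n; lia.
have ay0 : 0 < a%:R * theta + y by lra.
have az0 : 0 < a%:R * theta + z by lra.
rewrite IH// ?invr_ge0 ?ltW//.
set q := (denoms w).1 in q0 *; set q' := (denoms w).2 in q'0 *.
have -> : (a%:R * theta + y)^-1 - (a%:R * theta + z)^-1 =
    (z - y) / ((a%:R * theta + y) * (a%:R * theta + z)).
  by field; rewrite !gt_eqF.
have ly : 0 < a%:R * theta * q + q' + y * q by nra.
have lz : 0 < a%:R * theta * q + q' + z * q by nra.
rewrite normrM distrC normfV (gtr0_norm (mulr_gt0 ay0 az0)).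
have u0 : q + (a%:R * theta + y)^-1 * q' != 0.
  by rewrite gt_eqF// ltr_wpDr// mulr_ge0// invr_ge0 ltW.
have v0 : q + (a%:R * theta + z)^-1 * q' != 0.
  by rewrite gt_eqF// ltr_wpDr// mulr_ge0// invr_ge0 ltW.
rewrite -[LHS]mulrA -invfM; congr (_ / _).
by field; rewrite !gt_eqF.
Qed.

Lemma cyl_len_gt0 w : all (leq m) w -> 0 < cyl_len w.
Proof.
move=> /denomsP[q0 q'0 _]; rewrite divr_gt0// mulr_gt0//.
by rewrite ltr_wpDr// mulr_ge0// ltW.
Qed.

(** The extremal pair is [theta] and 0; clearing denominators leaves a sum of nonnegative terms. *)
Lemma branch_dist_le w y z : all (leq m) w -> 0 <= y <= theta ->
  0 <= z <= theta -> `|branch w y - branch w z| <= cyl_len w.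
Proof.
wlog zy : y z / z <= y.
  by move=> H; have [/H//|/ltW/H{}H wm yI zI] := leP z y; rewrite distrC H.
move=> wm /andP[y0 yt] /andP[z0 zt]; have [q0 q'0 _] := denomsP wm.
rewrite branch_dist// ger0_norm ?subr_ge0// /cyl_len.
set q := (denoms w).1 in q0 *; set q' := (denoms w).2 in q'0 *.
have t0 := theta_gt0.
have yq : 0 <= y * q' by rewrite mulr_ge0.
have zq : 0 <= z * q' by rewrite mulr_ge0.
have tq : 0 <= theta * q' by rewrite mulr_ge0// ltW.
rewrite ler_pdivrMr ?mulr_gt0 ?ltr_wpDr// mulrAC ler_pdivlMr ?mulr_gt0 ?ltr_wpDr//.
rewrite -subr_ge0.
have -> : theta * ((q + y * q') * (q + z * q')) - (y - z) * (q * (q + theta * q')) =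
   (theta - y) * q ^+ 2 + z * q ^+ 2 + 2 * (z * q' * (theta * q)) +
   theta * ((y * q') * (z * q')) by ring.
rewrite !addr_ge0// ?mulr_ge0// ?sqr_ge0// ?subr_ge0//; exact: ltW.
Qed.

(** In this form the lengths of the children telescope over [a]. *)
Lemma cyl_len_cons a w : (0 < a)%N -> all (leq m) w -> cyl_len (a :: w) =
  ((a%:R * theta * (denoms w).1 + (denoms w).2)^-1 -
   (a.+1%:R * theta * (denoms w).1 + (denoms w).2)^-1) / (denoms w).1.
Proof.
move=> a0 wm; have [q0 q'0 _] := denomsP wm; rewrite /cyl_len /= -natr1.
have aR : 0 < a%:R :> R by rewrite ltr0n.
set q := (denoms w).1 in q0 *; set q' := (denoms w).2 in q'0 *.
have t0 := theta_gt0.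
have tq : 0 < theta * q by rewrite mulr_gt0.
have atq : 0 < a%:R * (theta * q) by rewrite mulr_gt0.
by field; rewrite !gt_eqF//; lra.
Qed.

Lemma cyl_len_sq_le w : all (leq m) w -> cyl_len w <= theta / (denoms w).1 ^+ 2.
Proof.
move=> wm; have [q0 q'0 _] := denomsP wm; rewrite /cyl_len ler_pM2l// lef_pV2 ?posrE.
- by rewrite expr2 ler_pM2l// lerDl mulr_ge0// ltW.
- by rewrite mulr_gt0// ltr_wpDr// mulr_ge0// ltW.
- by rewrite exprn_gt0.
Qed.

Lemma cyl_len_sq_ge w : all (leq m) w ->
  theta / (denoms w).1 ^+ 2 <= (1 + theta ^+ 2) * cyl_len w.
Proof.
move=> wm; have [q0 q'0 q'q] := denomsP wm; rewrite /cyl_len mulrCA ler_pM2l//.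
have tq : 0 <= theta * (denoms w).2 by rewrite mulr_ge0// ltW.
rewrite ler_pdivlMr ?mulr_gt0 ?ltr_wpDr// mulrC ler_pdivrMr ?exprn_gt0//.
have := ler_pM2l theta_gt0 (denoms w).2 (theta * (denoms w).1); rewrite q'q; nra.
Qed.

(** Write [Q] for the new continuant. From [a theta >= 1 / theta >= theta] follow
    [q + theta q' <= theta Q] and [2 theta q <= Q + theta q], whence
    [2 q (q + theta q') <= Q (Q + theta q)]. *)
Lemma cyl_len_half a w : (m <= a)%N -> all (leq m) w ->
  cyl_len (a :: w) <= cyl_len w / 2.
Proof.
move=> ma wm; have [q0 q'0 _] := denomsP wm; rewrite /cyl_len /=.
set q := (denoms w).1 in q0 *; set q' := (denoms w).2 in q'0 *.
have t0 := theta_gt0; have t1 := theta_le1.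
have tq : 0 < theta * q by rewrite mulr_gt0.
have tq' : 0 <= theta * q' by rewrite mulr_ge0// ltW.
have at1 : 1 <= theta * (a%:R * theta).
  by rewrite -ler_pdivrMl// mulr1 digit_ge.
set A := a%:R * theta in at1 *.
have A0 : 0 < A by rewrite -(pmulr_rgt0 _ t0); lra.
have Ath : theta <= A by nra.
have h1 : q <= theta * (A * q + q') by nra.
have Aq : 0 < A * q by rewrite mulr_gt0.
rewrite -mulrA ler_pM2l// -invfM lef_pV2 ?posrE ?mulr_gt0//; [|lra..].
have h2 : q + theta * q' <= theta * (A * q + q') by nra.
have h3 : 2 * (theta * q) <= A * q + q' + theta * q by nra.
nra.
Qed.

(** The children with digits from [m + k] on fill at most the fraction [(m + 1) / (m + k)] of the
    cylinder; here [m + 1] is [(1 + theta^2) / theta^2]. *)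
Lemma cyl_len_sum k w : (0 < k)%N -> all (leq m) w ->
  (1 - (m%:R + 1) / (m + k)%:R) * cyl_len w <=
  \sum_(a <- iota m k) cyl_len (a :: w).
Proof.
move=> k0 wm; have [q0 q'0 q'q] := denomsP wm.
pose f a : R := - (a%:R * theta * (denoms w).1 + (denoms w).2)^-1 / (denoms w).1.
have -> : \sum_(a <- iota m k) cyl_len (a :: w) = f (m + k)%N - f m.
  rewrite -(telescope_sumr f (leq_addr k m)) /index_iota addKn.
  rewrite big_seq [RHS]big_seq; apply: eq_bigr => a; rewrite mem_iota => /andP[ma _].
  rewrite cyl_len_cons//; last exact: leq_trans ma.
  by rewrite /f -mulrBl; congr (_ / _); ring.
(* As [m theta = 1 / theta], the lower end of the telescoping sum is the whole cylinder. *)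
have -> : f m = - cyl_len w.
  rewrite /f /cyl_len mulNr -invfM -theta_inv; congr (- _).
  have tq : 0 <= theta * (denoms w).2 by rewrite mulr_ge0// ltW.
  field; rewrite !gt_eqF//; lra.
rewrite mulrBl mul1r opprK addrC lerD2r /f mulNr lerN2.
have : 0 < (m + k)%:R :> R by rewrite ltr0n; lia.
move: (m + k)%:R => N N0.
apply: le_trans (_ : N^-1 / theta / (denoms w).1 ^+ 2 <= _).
  rewrite expr2 -!invfM lef_pV2 ?posrE ?mulr_gt0//; last first.
    by rewrite ltr_wpDr// !mulr_gt0.
  by rewrite -mulrA mulrA mulrA ler_pM2r// lerDl.
rewrite -(ler_pM2r (exprn_gt0 2 theta_gt0)).
have -> : N^-1 / theta / (denoms w).1 ^+ 2 * theta ^+ 2 =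
          (theta / (denoms w).1 ^+ 2) / N.
  by field; rewrite !gt_eqF.
apply: (le_trans (ler_wpM2r _ (cyl_len_sq_ge wm))); first by rewrite invr_ge0 ltW.
rewrite le_eqVlt; apply/orP; left; apply/eqP.
have -> : (m%:R + 1) / N * cyl_len w * theta ^+ 2 =
   (m%:R * theta ^+ 2 + theta ^+ 2) / N * cyl_len w by ring.
by rewrite theta2; ring.
Qed.

(** Both factors in the denominator of the new length are at most [(b + 2) q], because [theta <= 1]
    and [q' <= q]. *)
Lemma cyl_len_cons_ge b w : (m <= b)%N -> all (leq m) w ->
  cyl_len w / b.+2%:R ^+ 2 <= cyl_len (b :: w).
Proof.
move=> mb wm; have [q0 q'0 q'q] := denomsP wm.
apply: (le_trans (ler_wpM2r _ (cyl_len_sq_le wm))); first by rewrite invr_ge0 sqr_ge0.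
rewrite /cyl_len /= -[X in X <= _]mulrA ler_pM2l// -invfM -exprMn.
have t0 := theta_gt0; have t1 := theta_le1.
have b0 : 0 < b%:R :> R by rewrite ltr0n; lia.
set q := (denoms w).1 in q0 q'q *; set q' := (denoms w).2 in q'0 q'q *.
have tq : 0 < theta * q by rewrite mulr_gt0.
have btq : 0 < b%:R * (theta * q) by rewrite mulr_gt0.
have -> : b.+2%:R = b%:R + 2 :> R by rewrite -addn2 natrD.
have tqq : theta * q <= q by rewrite ler_piMl// ltW.
have h1 : b%:R * theta * q + q' <= q * (b%:R + 2) by nra.
have h2 : b%:R * theta * q + q' + theta * q <= q * (b%:R + 2) by nra.
rewrite lef_pV2 ?posrE ?mulr_gt0 ?exprn_gt0//; [|nra..].
by rewrite expr2 ler_pM//; nra.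
Qed.

(** * Infinite expansions and their digits *)

Lemma rprefix_all (a : nat -> nat) n : (forall i, (m <= a i)%N) -> all (leq m) (rprefix a n).
Proof. by move=> ma; elim: n => //= n ->; rewrite ma. Qed.

Definition shift (a : nat -> nat) n : nat -> nat := fun i => a (n + i)%N.

Definition cf_val (a : nat -> nat) : R := lim (branch (rprefix a n) 0 @[n --> \oo]).

Lemma cyl_len_rprefix (a : nat -> nat) n : (forall i, (m <= a i)%N) ->
  cyl_len (rprefix a n) <= theta / 2 ^+ n.
Proof.
move=> ma; elim: n => [|n IH]; first by rewrite /cyl_len /= mulr0 addr0 mulr1 expr0.
apply: (le_trans (cyl_len_half (ma n) (rprefix_all n ma))).
by rewrite exprSr invfM mulrA ler_pM2r// invr_gt0.
Qed.

Lemma digit_inv_bounds b y : (m <= b)%N -> 0 <= y -> 0 <= (b%:R * theta + y)^-1 <= theta.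
Proof.
move=> mb y0; have t0 := theta_gt0; have := digit_ge mb => bt.
have ti : 0 < theta^-1 by rewrite invr_gt0.
apply/andP; split; first by rewrite invr_ge0; lra.
by rewrite -[leRHS]invrK lef_pV2 ?posrE//; lra.
Qed.

(** Consecutive convergents lie in a common cylinder of length at most [theta / 2^n], so their
    differences are absolutely summable. *)
Lemma cf_val_cvg (a : nat -> nat) : (forall i, (m <= a i)%N) ->
  branch (rprefix a n) 0 @[n --> \oo] --> cf_val a.
Proof.
move=> ma; pose x n := branch (rprefix a n) 0 : R.
suff : cvgn x by [].
have -> : x = (fun n => x 0%N + series (telescope x) n).
  by apply/funext => n; rewrite -eq_sum_telescope.
apply: is_cvgD; first exact: is_cvg_cst.
apply: normed_cvg; apply: (@series_le_cvg _ _ (geometric theta 2^-1)).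
- by move=> n; exact: normr_ge0.
- by move=> n; rewrite /geometric /= mulr_ge0 ?exprn_ge0 ?invr_ge0// ltW.
- move=> n; rewrite /telescope /x /= /geometric /= exprVn.
  apply: le_trans (cyl_len_rprefix n ma).
  apply: branch_dist_le; rewrite ?rprefix_all ?digit_inv_bounds//.
  by rewrite lexx ltW.
- by apply: is_cvg_geometric_series; rewrite ger0_norm ?invr_ge0// invf_lt1 ?ltr1n.
Qed.

Lemma branch_rcons w b y : branch (rcons w b) y = (b%:R * theta + branch w y)^-1.
Proof. by elim: w y => //= a w IH y; rewrite IH. Qed.

(** Words grow at the head; here the first digit is split off at the far end, as the recursion for
    [cf_val] requires. *)
Lemma rprefixS (a : nat -> nat) n : rprefix a n.+1 = rcons (rprefix (shift a 1) n) (a 0%N).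
Proof. by elim: n => //= n IH; rewrite -IH. Qed.

Lemma cf_val_ge0 (a : nat -> nat) : (forall i, (m <= a i)%N) -> 0 <= cf_val a.
Proof.
move=> ma; apply: (limr_ge (cf_val_cvg ma)).
by apply: nearW => n; exact: branch_ge0.
Qed.

Lemma cf_valE (a : nat -> nat) : (forall i, (m <= a i)%N) ->
  cf_val a = ((a 0%N)%:R * theta + cf_val (shift a 1))^-1.
Proof.
move=> ma; have ma1 i : (m <= shift a 1 i)%N by exact: ma.
have at0 : 0 < (a 0%N)%:R * theta by rewrite mulr_gt0// ltr0n (leq_trans m_gt0).
apply: cvg_lim => //; rewrite -cvg_shiftS.
rewrite (_ : [sequence _]_n = fun n =>
  ((a 0%N)%:R * theta + branch (rprefix (shift a 1) n) 0)^-1); last first.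
  by apply/funext => n; rewrite -branch_rcons -rprefixS.
apply: cvgV; first by rewrite gt_eqF// ltr_wpDr// cf_val_ge0.
by apply: cvgD; [exact: cvg_cst|exact: cf_val_cvg].
Qed.

Lemma cf_val_bounds (a : nat -> nat) : (forall i, (m <= a i)%N) -> 0 < cf_val a < theta.
Proof.
have gt0 c : (forall i, (m <= c i)%N) -> 0 < cf_val c.
  move=> mc; rewrite cf_valE// invr_gt0 ltr_wpDr ?cf_val_ge0//.
    by move=> i; exact: mc.
  by rewrite mulr_gt0// ltr0n (leq_trans m_gt0).
move=> ma; have ma1 i : (m <= shift a 1 i)%N by exact: ma.
rewrite gt0//= cf_valE// -[ltRHS]invrK ltf_pV2 ?posrE ?invr_gt0//.
  by rewrite (le_lt_trans (digit_ge (ma 0%N)))// ltrDl gt0.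
by rewrite addr_gt0 ?gt0// mulr_gt0// ltr0n (leq_trans m_gt0).
Qed.

Lemma cf_val_branch (a : nat -> nat) n : (forall i, (m <= a i)%N) ->
  cf_val a = branch (rprefix a n) (cf_val (shift a n)).
Proof.
move=> ma; elim: n => [//|n IH] /=; rewrite IH; congr (branch _ _).
rewrite cf_valE; last by move=> i; exact: ma.
rewrite /shift addn0; do 2 f_equal; congr cf_val.
by apply/funext => i; rewrite addnA addn1.
Qed.

(** With [x] the value and [y] the tail, [1 / (x theta)] is [a 0 + y / theta], and
    [0 <= y / theta < 1]. *)
Lemma digit1_cf_val (a : nat -> nat) : (forall i, (m <= a i)%N) ->
  (cf_val a != 0) * (Num.floor (cf_val a * theta)^-1 = (a 0%N)%:Z).
Proof.
move=> ma; have /andP[x0 _] := cf_val_bounds ma; split; first by rewrite gt_eqF.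
have /andP[y0 yt] : 0 < cf_val (shift a 1) < theta.
  by apply: cf_val_bounds => i; exact: ma.
apply/floor_def; rewrite invfM (cf_valE ma) invrK mulrDl mulfK ?gt_eqF//.
rewrite intrD -pmulrn lerDl ltrD2l divr_ge0 ?ltW//=.
by rewrite ltr_pdivrMr// mul1r.
Qed.

Lemma T_map_cf_val (a : nat -> nat) : (forall i, (m <= a i)%N) ->
  T_map theta (cf_val a) = cf_val (shift a 1).
Proof.
move=> ma; rewrite /T_map (negbTE (digit1_cf_val ma).1) (digit1_cf_val ma).2.
by rewrite {1}(cf_valE ma) invrK -pmulrn; ring.
Qed.

Lemma digit_cf_val (a : nat -> nat) n : (forall i, (m <= a i)%N) ->
  digit theta n.+1 (cf_val a) = (a n)%:R%:E.
Proof.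
move=> ma; rewrite /digit /=.
have -> : iter n (T_map theta) (cf_val a) = cf_val (shift a n).
  elim: n => //= n ->; rewrite T_map_cf_val; last by move=> i; exact: ma.
  by congr cf_val; apply/funext => i; rewrite /shift addnA addn1.
have man i : (m <= shift a n i)%N by exact: ma.
by rewrite /digit1 (negbTE (digit1_cf_val man).1) (digit1_cf_val man).2 /shift addn0.
Qed.

Lemma max_digit_cf_val (c : nat -> nat) n : (forall i, (m <= c i)%N) ->
  max_digit theta n.+1 (cf_val c) = (\max_(i < n.+1) c i)%:R%:E.
Proof.
move=> mc; rewrite /max_digit; elim: n => [|n IH].
  by rewrite big_nat1 big_ord_recl big_ord0 maxn0 digit_cf_val.
rewrite big_nat_recr//= IH digit_cf_val// -EFin_max.
rewrite [\max_(i < n.+2) _]big_ord_recr /=.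
congr (_%:E); have [h|/ltnW h] := leqP (\max_(i < n.+1) c i) (c n.+1).
  by rewrite max_r// ler_nat.
by rewrite max_l// ler_nat.
Qed.

(** * Separation of the branches of the tree *)

Section Gaps.
Context (k : nat) (A : nat -> seq nat) (k_gt0 : (0 < k)%N).
Context (A_levels : forall n,
  A n = iota m k \/ exists2 b, (m <= b)%N & A n = [:: b]).

Lemma level_ge n b : b \in A n -> (m <= b)%N.
Proof.
case: (A_levels n) => [->|[d md ->]]; first by rewrite mem_iota => /andP[].
by rewrite inE => /eqP ->.
Qed.

Lemma cf_val_free_ge (c : nat -> nat) : (forall i, (m <= c i)%N) -> c 0%N \in iota m k ->
  ((m + k)%:R * theta)^-1 <= cf_val c.
Proof.
move=> mc; rewrite mem_iota => /andP[_ c0]; rewrite cf_valE//.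
have /andP[y0 yt] : 0 < cf_val (shift c 1) < theta.
  by apply: cf_val_bounds => i; exact: mc.
have c0R : (c 0%N)%:R + 1 <= (m + k)%:R :> R by rewrite natr1 ler_nat.
have c00 : 0 < (c 0%N)%:R :> R by rewrite ltr0n (leq_trans m_gt0).
have t0 := theta_gt0.
have h : ((c 0%N)%:R + 1) * theta <= (m + k)%:R * theta by rewrite ler_pM2r.
have h' : 0 < (c 0%N)%:R * theta by rewrite mulr_gt0.
by rewrite lef_pV2 ?posrE//; lra.
Qed.

(** At a free level both tails lie between [1 / ((m + k) theta)] and [theta]; at a forced level they
    share a cylinder of length at most [theta / 2]. *)
Lemma tree_tails_close (c d : nat -> nat) n :
  (forall i, c i \in A i) -> (forall i, d i \in A i) ->
  `|cf_val (shift c n) - cf_val (shift d n)| <= theta * (1 - (m + k)%:R^-1).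
Proof.
move=> cA dA.
have mc i : (m <= shift c n i)%N by exact: level_ge (cA _).
have md i : (m <= shift d n i)%N by exact: level_ge (dA _).
have t0 := theta_gt0; have m1 := mR_ge1.
have N2 : 2 <= (m + k)%:R :> R by rewrite (ler_nat R 2); lia.
have [An|[b mb An]] := A_levels n.
- have /andP[_ ct] := cf_val_bounds mc; have /andP[_ dt] := cf_val_bounds md.
  have := cf_val_free_ge mc; have := cf_val_free_ge md.
  rewrite /shift addn0 -An cA dA => /(_ isT) + /(_ isT).
  rewrite invfM theta_inv.
  have : (m + k)%:R^-1 * theta <= (m + k)%:R^-1 * (m%:R * theta).
    rewrite ler_pM2l ?invr_gt0; last lra.
    by rewrite ler_peMl// ltW.
  rewrite /shift in ct dt; move: (m + k)%:R^-1 => N; rewrite ler_norml; lra.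
- rewrite cf_valE// [X in _ - X]cf_valE//.
  have -> : shift c n 0 = b by move: (cA n); rewrite /shift addn0 An inE => /eqP.
  have -> : shift d n 0 = b by move: (dA n); rewrite /shift addn0 An inE => /eqP.
  have /andP[y0 yt] : 0 < cf_val (shift (shift c n) 1) < theta.
    by apply: cf_val_bounds => i; exact: mc.
  have /andP[z0 zt] : 0 < cf_val (shift (shift d n) 1) < theta.
    by apply: cf_val_bounds => i; exact: md.
  have bm : all (leq m) [:: b] by rewrite /= mb.
  have le2 (x : R) : 0 < x -> x < theta -> 0 <= x <= theta by move=> *; rewrite !ltW.
  apply: (le_trans (branch_dist_le bm (le2 _ y0 yt) (le2 _ z0 zt))).
  apply: (le_trans (@cyl_len_half b [::] mb isT)).
  rewrite /cyl_len /= mulr0 addr0 mulr1 divr1 ler_pM2l//.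
  have : (m + k)%:R^-1 <= 2^-1 :> R by rewrite lef_pV2 ?posrE//; lra.
  lra.
Qed.

(** Where the digits first differ, the reciprocals of the tails differ by at least [theta], less the
    [theta (1 - 1 / (m + k))] that the next tails can cancel. *)
Lemma tree_gap (c d : nat -> nat) n :
  (forall i, c i \in A i) -> (forall i, d i \in A i) ->
  rprefix c n = rprefix d n -> c n != d n ->
  cyl_len (rprefix c n) / (4 * (m + k)%:R ^+ 3) <= `|cf_val c - cf_val d|.
Proof.
move=> cA dA cdn cd.
have mc i : (m <= c i)%N by exact: level_ge (cA _).
have md i : (m <= d i)%N by exact: level_ge (dA _).
have An : A n = iota m k.
  have [//|[b _ An]] := A_levels n.
  by move: (cA n) (dA n) cd; rewrite An !inE => /eqP -> /eqP ->; rewrite eqxx.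
have close := tree_tails_close n.+1 cA dA.
have wm := rprefix_all n mc.
rewrite (cf_val_branch n mc) (cf_val_branch n md) -cdn.
have mc' i : (m <= shift c n i)%N by exact: mc.
have md' i : (m <= shift d n i)%N by exact: md.
have /andP[Y0 Yt] := cf_val_bounds mc'; have /andP[Z0 Zt] := cf_val_bounds md'.
rewrite (branch_dist wm (ltW Y0) (ltW Z0)).
have [q0 q'0 q'q] := denomsP wm.
set q := (denoms _).1 in q0 q'q *; set q' := (denoms _).2 in q'0 q'q *.
have t0 := theta_gt0; have t1 := theta_le1.
have N0 : 0 < (m + k)%:R :> R by rewrite ltr0n; lia.
have YZ : (m + k)%:R ^- 3 / theta <= `|cf_val (shift c n) - cf_val (shift d n)|.
  have := cf_val_free_ge mc'; have := cf_val_free_ge md'.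
  rewrite /shift !addn0 -An cA dA => /(_ isT) Zge /(_ isT) Yge.
  have sE (e : nat -> nat) : shift (shift e n) 1 = shift e n.+1.
    by apply/funext => i; rewrite /shift addnA addn1.
  have Y1 : cf_val (shift c n) = ((c n)%:R * theta + cf_val (shift c n.+1))^-1.
    by rewrite cf_valE// sE /shift addn0.
  have Z1 : cf_val (shift d n) = ((d n)%:R * theta + cf_val (shift d n.+1))^-1.
    by rewrite cf_valE// sE /shift addn0.
  have -> : cf_val (shift c n) - cf_val (shift d n) =
      cf_val (shift c n) * cf_val (shift d n) *
      (((d n)%:R - (c n)%:R) * theta + (cf_val (shift d n.+1) - cf_val (shift c n.+1))).
    transitivity (cf_val (shift c n) * cf_val (shift d n) *
      ((cf_val (shift d n))^-1 - (cf_val (shift c n))^-1)).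
      by field; rewrite !gt_eqF.
    by congr (_ * _); rewrite Y1 Z1 !invrK; ring.
  rewrite normrM (gtr0_norm (mulr_gt0 Y0 Z0)).
  have -> : (m + k)%:R ^- 3 / theta =
      (((m + k)%:R * theta)^-1 * ((m + k)%:R * theta)^-1) * (theta * (m + k)%:R^-1).
    by move: (m + k)%:R N0 => N N0; field; rewrite !gt_eqF.
  apply: ler_pM.
  - by rewrite mulr_ge0// invr_ge0 mulr_ge0// ltW.
  - by rewrite mulr_ge0// ?invr_ge0 ltW.
  - by apply: ler_pM; rewrite // invr_ge0 mulr_ge0// ltW.
  - have dc : 1 <= `|(d n)%:R - (c n)%:R| :> R.
      have := cd; rewrite neq_ltn => /orP[lt|lt]; [|rewrite distrC];
      by rewrite -natrB 1?ltnW// normr_nat ler1n subn_gt0.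
    rewrite distrC in close.
    have := lerB_normD (((d n)%:R - (c n)%:R) * theta)
      (cf_val (shift d n.+1) - cf_val (shift c n.+1)).
    apply: le_trans; rewrite normrM (gtr0_norm t0).
    have : 1 * theta <= `|(d n)%:R - (c n)%:R| * theta by rewrite ler_pM2r.
    by move: close; move: (m + k)%:R^-1 => N; lra.
(* The factor 4 of the gap comes from denominators at most [2 q]; [theta <= 1] absorbs the powers of
   [theta]. *)
apply: (@le_trans _ _ ((m + k)%:R ^- 3 / theta / (2 * q * (2 * q)))).
  apply: (le_trans (ler_wpM2r _ (cyl_len_sq_le wm))).
    by rewrite invr_ge0 mulr_ge0// exprn_ge0// ltW.
  rewrite -/q.
  have -> : theta / q ^+ 2 / (4 * (m + k)%:R ^+ 3) =
     theta * ((m + k)%:R ^- 3 / (2 * q * (2 * q))).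
    by move: (m + k)%:R N0 => N N0; field; rewrite !gt_eqF.
  have -> : (m + k)%:R ^- 3 / theta / (2 * q * (2 * q)) =
     theta^-1 * ((m + k)%:R ^- 3 / (2 * q * (2 * q))).
    by move: (m + k)%:R N0 => N N0; field; rewrite !gt_eqF.
  apply: ler_wpM2r.
    by rewrite mulr_ge0// invr_ge0 ?exprn_ge0 ?mulr_ge0// ltW.
  by rewrite (le_trans t1)// invf_ge1.
have den y : 0 < y -> y < theta -> 0 < q + y * q' <= 2 * q.
  move=> y0 yt.
  have h1 : y * q' <= 1 * q' by rewrite ler_wpM2r//; lra.
  have h2 : theta * q <= 1 * q by rewrite ler_pM2r.
  have h3 : 0 <= y * q' by rewrite mulr_ge0// ltW.
  by apply/andP; split; lra.
have /andP[dY dY2] := den _ Y0 Yt; have /andP[dZ dZ2] := den _ Z0 Zt.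
apply: ler_pM => //.
- by rewrite mulr_ge0// invr_ge0 ?exprn_ge0// ltW.
- by rewrite invr_ge0 !mulr_ge0// ltW.
- by rewrite lef_pV2 ?posrE ?mulr_gt0//; apply: ler_pM => //; exact: ltW.
Qed.

End Gaps.

(** * The gain at free levels *)

Lemma cyl_len_pow_sum (s : R) k w : 0 < s < 1 -> (0 < k)%N -> all (leq m) w ->
  2 `^ (1 - s) * (1 - (m%:R + 1) / (m + k)%:R) * cyl_len w `^ s <=
  \sum_(a <- iota m k) cyl_len (a :: w) `^ s.
Proof.
move=> /andP[s0 s1] k0 wm; have l0 := cyl_len_gt0 wm.
have B0 : 0 < 2 `^ (1 - s) :> R by rewrite powR_gt0.
(* A child is at most half as long and [s - 1 < 0], so its length to the power [s - 1] gains
   [2^(1 - s)] over that of [w]. *)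
have step a : a \in iota m k ->
    2 `^ (1 - s) * cyl_len w `^ (s - 1) * cyl_len (a :: w) <= cyl_len (a :: w) `^ s.
  rewrite mem_iota => /andP[ma _].
  have awm : all (leq m) (a :: w) by rewrite /= ma.
  have la0 := cyl_len_gt0 awm.
  rewrite -(mulr_powRB1 (ltW la0) s0) [leRHS]mulrC ler_pM2r//.
  rewrite -[s - 1]opprB !powRN -invf_div lef_pV2 ?posrE ?divr_gt0 ?powR_gt0//.
  rewrite ler_pdivlMr// -powRM// ?(ltW la0)//; apply: ge0_ler_powR; rewrite ?nnegrE; try lra.
  by rewrite -ler_pdivlMr// cyl_len_half.
rewrite [leRHS]big_seq.
apply: le_trans (ler_sum _ step); rewrite -mulr_sumr -big_seq.
rewrite -[leLHS]mulrA -[leRHS]mulrA ler_pM2l// -(mulr_powRB1 (ltW l0) s0).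
rewrite mulrA mulrC ler_wpM2l ?powR_ge0//.
exact: cyl_len_sum.
Qed.

Lemma exists_free_width (s : R) : 0 < s < 1 -> exists k lam, [/\ (0 < k)%N, 1 < lam &
  forall w, all (leq m) w ->
    lam * cyl_len w `^ s <= \sum_(a <- iota m k) cyl_len (a :: w) `^ s].
Proof.
move=> sI; have /andP[s0 s1] := sI.
set B : R := 2 `^ (1 - s).
have B1 : 1 < B.
  have := @gt0_ltr_powR R (1 - s) _ 1 2; rewrite powR1 !nnegrE; apply; lra.
(* This [k] makes [(m + 1) / (m + k)] at most [(B - 1) / (2 B)], which leaves the factor
   [(1 + B) / 2]. *)
pose k := (Num.truncn ((m%:R + 1) * (2 * B / (B - 1)))).+1.
exists k, ((1 + B) / 2); split=> //; first by lra.
move=> w wm; apply: le_trans (cyl_len_pow_sum sI (ltn0Sn _) wm).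
apply: ler_wpM2r; rewrite ?powR_ge0// -/B -/k.
have kgt : (m%:R + 1) * (2 * B / (B - 1)) < k%:R by exact: truncnS_gt.
have m1 := mR_ge1.
have N0 : 0 < (m + k)%:R :> R by rewrite ltr0n; lia.
have kN : k%:R <= (m + k)%:R :> R by rewrite ler_nat leq_addl.
have h : (m%:R + 1) * (2 * B) <= (m + k)%:R * (B - 1).
  by rewrite -ler_pdivrMr ?subr_gt0// -mulrA; lra.
have : (m%:R + 1) / (m + k)%:R * (2 * B) <= B - 1.
  by rewrite mulrAC ler_pdivrMr// mulrC [leRHS]mulrC (mulrC (2 * B)).
by move: (_ / _) => X; lra.
Qed.

(** * The tree of admissible words and its mass *)

Section CantorSet.
Context (s lam : R) (k : nat) (D : nat -> nat) (C : R).
Context (sI : 0 < s < 1) (k_gt0 : (0 < k)%N) (lam_gt1 : 1 < lam).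
Context (free_sum : forall w, all (leq m) w ->
  lam * cyl_len w `^ s <= \sum_(a <- iota m k) cyl_len (a :: w) `^ s).
Context (D_ge : forall n, (m <= D n)%N).
Context (D_le : forall n, (D n).+2%:R ^+ 2 <= C * n.+1%:R ^+ 2).

Definition level n := if forced lam C n then [:: D n] else iota m k.

Lemma levelP n : level n = iota m k \/ exists2 b, (m <= b)%N & level n = [:: b].
Proof. by rewrite /level; case: ifP => _; [right; exists (D n)|left]. Qed.

Lemma tree_word_ge w : tree_word level w -> all (leq m) w.
Proof.
by elim: w => //= a w IH /andP[/(level_ge levelP) -> /IH].
Qed.

Let gap : R := (4 * (m + k)%:R ^+ 3)^-1.

Let gap_gt0 : 0 < gap.
Proof. by rewrite invr_gt0 mulr_gt0// exprn_gt0// ltr0n addn_gt0 m_gt0. Qed.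

(** The factor [gap^s] makes a set lighter than [nu w] shorter than the gaps between the children of
    [w]. *)
Let nu w : R := gap `^ s * weight lam C (size w) * cyl_len w `^ s.

Let nu_le w : all (leq m) w -> nu w <= (gap * cyl_len w) `^ s.
Proof.
move=> wm; rewrite powRM; [|exact: ltW..|exact/ltW/cyl_len_gt0].
rewrite ler_wpM2r ?powR_ge0// ler_piMr ?powR_ge0//.
by have /andP[] := weight_bounds C (size w) lam_gt1.
Qed.

(** At a free level the gain [lam] cancels the decay of the weight. At a forced level the weight is
    at most [b.+2^-2], hence at most its power [s], which pays for the shrinking. *)
Let nu_sum w : tree_word level w -> nu w <= \sum_(a <- level (size w)) nu (a :: w).
Proof.
move=> /tree_word_ge wm; have /andP[s0 s1] := sI.
have lam0 : 0 < lam by exact: lt_trans lam_gt1.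
have /andP[F0 F1] := weight_bounds C (size w) lam_gt1.
have l0 := cyl_len_gt0 wm.
rewrite /nu /level -mulrA; under eq_bigr do rewrite -mulrA.
rewrite -mulr_sumr ler_wpM2l ?powR_ge0//.
have [f|f] := boolP (forced lam C (size w)); last first.
  under eq_bigr do rewrite [size (_ :: _)]/= weightS (negbTE f).
  rewrite -mulr_sumr -mulrA.
  by rewrite ler_wpM2l ?(ltW F0)// ler_pdivlMl// free_sum.
rewrite big_seq1 [size (_ :: _)]/= weightS f mul1r.
set b := D (size w).
have b0 : 0 < b.+2%:R ^+ 2 :> R by rewrite exprn_gt0.
have Fb : weight lam C (size w) <= (b.+2%:R ^+ 2)^-1.
  rewrite -[leRHS]mul1r ler_pdivlMr//; apply: le_trans f.
  by rewrite mulrC ler_wpM2r ?(ltW F0)// D_le.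
have bs : (b.+2%:R ^+ 2)^-1 <= ((b.+2%:R ^+ 2)^-1) `^ s :> R.
  rewrite ger1_powR ?(ltW s1)// invr_gt0 b0 invf_le1//.
  by rewrite expr_ge1// ler1n.
apply: (@le_trans _ _ (((b.+2%:R ^+ 2)^-1) `^ s * cyl_len w `^ s)).
  by rewrite ler_wpM2r ?powR_ge0// (le_trans Fb).
rewrite -powRM ?invr_ge0 ?(ltW b0) ?(ltW l0)//.
have bwm : all (leq m) (b :: w) by rewrite /= D_ge.
apply: ge0_ler_powR; rewrite ?nnegrE ?(ltW s0) ?(ltW (cyl_len_gt0 bwm))//.
  by rewrite mulr_ge0// ?invr_ge0 ltW.
by rewrite mulrC; apply: cyl_len_cons_ge => //; exact: D_ge.
Qed.

Lemma cantor_avoidance : exists2 e : R, 0 < e &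
  forall (V : nat -> set R) (u : nat -> R), (forall i, 0 < u i) ->
  (forall i x y, V i x -> V i y -> `|x - y| `^ s <= u i) ->
  (\sum_(0 <= i <oo) (u i)%:E < e%:E)%E ->
  exists2 c : nat -> nat, forall n, c n \in level n & forall i, ~ V i (cf_val c).
Proof.
exists ((gap * theta) `^ s) => [|V u u0 Vu u_lt].
  by rewrite powR_gt0// mulr_gt0.
have /andP[s0 s1] := sI.
(* A set hits a word when it contains the value of some branch of the tree through that word. *)
pose hits i w := `[< exists c : nat -> nat, [/\ forall n, c n \in level n,
  rprefix c (size w) = w & V i (cf_val c)] >].
have level_uniq n : uniq (level n).
  by rewrite /level; case: ifP => // _; exact: iota_uniq.
have hits_cons i a w : hits i (a :: w) -> hits i w.
  by move=> /asboolP[c [cA /= [_ cw] Vc]]; apply/asboolP; exists c.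
have hits_inj i w a b : tree_word level w -> u i < nu w ->
    a \in level (size w) -> b \in level (size w) ->
    hits i (a :: w) -> hits i (b :: w) -> a = b.
  move=> tw uw _ _ /asboolP[c [cA /= [ca cw] Vc]] /asboolP[d [dA /= [da dw] Vd]].
  apply/eqP; apply: contraT => ab; rewrite -ca -da in ab.
  have wm := tree_word_ge tw.
  have := tree_gap k_gt0 levelP cA dA (etrans cw (esym dw)) ab.
  rewrite cw -/gap mulrC => g.
  have : nu w <= u i.
    apply: (le_trans (nu_le wm)); apply: le_trans (Vu _ _ _ Vc Vd).
    apply: ge0_ler_powR; rewrite ?nnegrE ?(ltW s0)//.
    by rewrite mulr_ge0// ltW// cyl_len_gt0.
  by rewrite leNgt uw.
have nu0 : nu [::] = (gap * theta) `^ s.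
  rewrite /nu /= mulr1 powRM ?ltW//; congr (_ * _ `^ _).
  by rewrite /cyl_len /= mulr0 addr0 mulr1 divr1.
rewrite -nu0 in u_lt.
have [c cA cP] := tree_avoidance level_uniq (fun i => ltW (u0 i)) hits_cons nu_sum
  hits_inj u_lt.
exists c => // i Vc.
have mc n : (m <= c n)%N by exact: level_ge levelP _ _ (cA n).
have size_pre n : size (rprefix c n) = n by elim: n => //= n ->.
have lt_nu n : u i < nu (rprefix c n).
  by apply: cP; apply/asboolP; exists c; rewrite size_pre.
(* If [V i] contained the limit, it would hit every prefix, although the masses of the prefixes tend
   to 0 while [u i > 0]. *)
pose r := u i `^ s^-1.
have r0 : 0 < r by rewrite powR_gt0.
pose n := (Num.truncn r^-1).+1.
have : nu (rprefix c n) <= u i; last by rewrite leNgt lt_nu.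
apply: (le_trans (nu_le (rprefix_all n mc))).
have -> : u i = r `^ s by rewrite /r -powRrM mulVf ?gt_eqF// powRr1// ltW.
have t1 := theta_le1; have t0 := theta_gt0.
apply: ge0_ler_powR; rewrite ?nnegrE ?(ltW s0) ?(ltW r0)//.
  by rewrite mulr_ge0// ltW// cyl_len_gt0// rprefix_all.
have gap1 : gap <= 1.
  rewrite invf_le1 ?mulr_gt0 ?exprn_gt0// ?ltr0n ?addn_gt0 ?m_gt0//.
  have : 1 <= (m + k)%:R ^+ 3 :> R by rewrite expr_ge1// ler1n addn_gt0 m_gt0.
  by lra.
have lle : cyl_len (rprefix c n) <= r.
  apply: (le_trans (cyl_len_rprefix n mc)).
  apply: (@le_trans _ _ (2 ^+ n)^-1).
    by rewrite ler_piMl// invr_ge0 exprn_ge0.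
  rewrite -[leRHS]invrK lef_pV2 ?posrE ?invr_gt0 ?exprn_gt0//.
  apply/ltW; apply: (lt_le_trans (truncnS_gt _)).
  by rewrite -natrX ler_nat ltnW// ltn_expl.
apply: le_trans lle; rewrite ler_piMl// ltW// cyl_len_gt0// rprefix_all//.
Qed.

Lemma level_lt n b : b \in level n -> b = D n \/ (b < m + k)%N.
Proof.
rewrite /level; case: ifP => _; first by rewrite inE => /eqP; left.
by rewrite mem_iota => /andP[_]; right.
Qed.

End CantorSet.

(** * Growth of the maximal digit along a branch *)

Section Growth.
Context (lam eta : R) (k : nat) (lam_gt1 : 1 < lam) (eta_ge0 : 0 <= eta).

Let C : R := (m%:R + 2 + eta) ^+ 2.

(** Free digits stay below [m + k] and are negligible. Monotonicity bounds the forced digits above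
    by the value at [n], and a forced level near [n] gives the lower bound. *)
Lemma cf_val_in_E_set (c : nat -> nat) :
  (forall n, c n \in level lam k (big_digit eta m) C n) ->
  ~ rational (cf_val c) -> E_set theta eta (cf_val c).
Proof.
move=> cA irr.
have D_ge n : (m <= big_digit eta m n)%N by exact: leq_addr.
have mc n : (m <= c n)%N by exact: level_ge (levelP lam k C D_ge) _ _ (cA n).
split; first by split=> //=; rewrite in_itv /= cf_val_bounds.
pose L n : R := (\max_(i < n) c i)%:R.
suff h : L n * (ln (ln n%:R) / n%:R) @[n --> \oo] --> eta.
  (* The index 0 is shifted away, since the maximum over no digits is [-oo]. *)
  rewrite -cvg_shiftS; rewrite -cvg_shiftS in h.
  rewrite [X in X @ _ --> _](_ : _ =
    EFin \o (fun n => L n.+1 * (ln (ln n.+1%:R) / n.+1%:R))).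
    by apply: cvg_comp h _.
  by apply/funext => n /=; rewrite max_digit_cf_val.
have C0 : 0 <= C by rewrite sqr_ge0.
suff H (e : R) : 0 < e ->
    \forall n \near \oo, `|eta - L n * (ln (ln n%:R) / n%:R)| <= e.
  exact/cvgrPdist_le.
(* This choice gives both [eps < 1] and [eta eps <= e]. *)
move=> e0; pose eps : R := e / (e + eta + 1).
have eta0 := eta_ge0; have d0 : 0 < e + eta + 1 by lra.
have eps_eta : eta * eps <= e.
  rewrite /eps mulrCA ler_piMr ?(ltW e0)// ler_pdivrMr//.
  by lra.
have epsI : 0 < eps < 1.
  by rewrite divr_gt0//= ltr_pdivrMr//; lra.
have [N NP] := forced_dense lam_gt1 C0 epsI.
have mk0 : 0 < (m + k)%:R :> R by rewrite ltr0n addn_gt0 m_gt0.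
near=> n.
have /NP[i [fi ltin ige]] : (N <= n)%N by near: n; exact: nbhs_infty_ge.
(* It ensures [i.+1 >= exp (exp 1)], so that [ln (ln i.+1) >= 1]. *)
have nX : expR (expR 1) / (1 - eps) <= n%:R by near: n; exact: nbhs_infty_ger.
have nL : ln (ln n%:R) <= e / (m + k)%:R * n%:R.
  by near: n; apply: loglog_small; rewrite divr_gt0.
have n0 : 0 < n%:R :> R by rewrite ltr0n (leq_ltn_trans _ ltin).
rewrite ler_pdivrMr in nX; last lra.
have iX : expR (expR 1) <= i.+1%:R :> R by lra.
have lli : 1 <= ln (ln i.+1%:R) :> R.
  have lx : expR 1 <= ln i.+1%:R :> R by rewrite -ler_expR lnK ?posrE.
  by rewrite -ler_expR lnK// posrE (lt_le_trans (expR_gt0 1)).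
have lln : ln (ln i.+1%:R) <= ln (ln n%:R) :> R.
  have [? ?] := loglog_ge1 lli.
  by rewrite ler_ln ?posrE ?ln_gt0 ?ler_ln ?posrE// ?ler_nat//;
     rewrite (lt_le_trans (y := i.+1%:R))// ler_nat.
have ll0 : 0 < ln (ln n%:R) :> R by lra.
have upper : L n <= (m + k)%:R + eta * (n%:R / ln (ln n%:R)).
  have cn : (0 < #|'I_n|)%N by rewrite card_ord (leq_ltn_trans _ ltin).
  rewrite /L; have [j ->] := bigop.eq_bigmax (fun i : 'I_n => c i) cn.
  have [->|lt] := level_lt (cA j).
    apply: (le_trans (big_digit_le _ eta_ge0 (ltn_ord j) ll0)).
    by rewrite lerD2r ler_nat leq_addr.
  apply: (@le_trans _ _ (m + k)%:R); first by rewrite ler_nat ltnW.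
  by rewrite lerDl mulr_ge0// divr_ge0// ltW.
have lower : eta * (i.+1%:R / ln (ln i.+1%:R)) <= L n.
  apply: (le_trans (big_digit_ge eta m_gt0 lli)).
  have := cA i; rewrite /level fi inE => /eqP <-.
  by rewrite ler_nat; exact: (leq_bigmax (Ordinal ltin)).
have w0 : 0 < ln (ln n%:R) / n%:R :> R by rewrite divr_gt0.
rewrite ler_distlC; apply/andP; split.
- have : eta * (i.+1%:R / ln (ln i.+1%:R)) * (ln (ln n%:R) / n%:R) <=
      L n * (ln (ln n%:R) / n%:R) by rewrite ler_pM2r.
  apply: le_trans.
  have : eta * (1 - eps) <= eta * (i.+1%:R / ln (ln i.+1%:R) * (ln (ln n%:R) / n%:R)).
    rewrite ler_wpM2l//.
    have -> : i.+1%:R / ln (ln i.+1%:R) * (ln (ln n%:R) / n%:R) =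
        i.+1%:R / n%:R * (ln (ln n%:R) / ln (ln i.+1%:R)) :> R.
      by move: (i.+1%:R) lli => I lli; field; rewrite !gt_eqF//; lra.
    rewrite -[leLHS]mulr1 ler_pM//; first by lra.
      by rewrite ler_pdivlMr.
    by rewrite ler_pdivlMr ?mul1r//; lra.
  rewrite mulrA; lra.
- have : L n * (ln (ln n%:R) / n%:R) <=
     ((m + k)%:R + eta * (n%:R / ln (ln n%:R))) * (ln (ln n%:R) / n%:R).
    by rewrite ler_pM2r.
  move=> /le_trans; apply.
  have -> : ((m + k)%:R + eta * (n%:R / ln (ln n%:R))) * (ln (ln n%:R) / n%:R) =
     (m + k)%:R * ln (ln n%:R) / n%:R + eta.
    by move: (m + k)%:R => M; field; rewrite !gt_eqF.
  rewrite addrC lerD2l ler_pdivrMr// mulrC -ler_pdivlMr//.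
  by rewrite mulrAC.
Unshelve. all: by end_near. Qed.

End Growth.

(** * Lower and upper bounds for the dimension *)

Lemma E_set_positive (s : R) (eta : R) : 0 <= s < 1 -> 0 <= eta ->
  hausdorff_measure s (E_set theta eta) <> 0%E.
Proof.
move=> /andP[s0 s1] eta0 mE.
(* A positive exponent strictly between [s] and 1: even for [s = 0], singletons then have zero
   cost. *)
pose t := (s + 1) / 2.
have tI : 0 < t < 1 by rewrite /t; apply/andP; split; lra.
have /andP[t0 _] := tI.
have st : 0 <= s <= t by rewrite /t s0; lra.
have [k [lam [k0 lam1 lamP]]] := exists_free_width tI.
have D_ge n : (m <= big_digit eta m n)%N by exact: leq_addr.
have D_le n := big_digit_le_linear m n eta0.
have [e e0 avoid] := cantor_avoidance tI k0 lam1 lamP D_ge D_le.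
have [V [u [u0 Vu ue EV]]] := null_cover_rational st t0 mE e0.
have [c cA cV] := avoid V u u0 Vu ue.
have nV : ~ (E_set theta eta `|` rational) (cf_val c) by move=> /EV[i _ /cV].
apply: nV; left; apply: (cf_val_in_E_set lam1 eta0 cA) => rc.
by have [i _ /cV] := EV _ (or_intror rc).
Qed.

End Branches.

Theorem theorem5p5 (R : realType) (m : nat) (m_gt0 : (0 < m)%N)
    (theta : R) (theta_def : theta = 1 / Num.sqrt m%:R)
    (eta : R) (eta_ge0 : 0 <= eta) :
  hausdorff_dim (E_set theta eta) = 1%E.
Proof.
have mR0 : 0 < m%:R :> R by rewrite ltr0n.
have theta_gt0 : 0 < theta by rewrite theta_def divr_gt0// sqrtr_gt0.
have theta2 : m%:R * theta ^+ 2 = 1.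
  by rewrite theta_def div1r exprVn sqr_sqrtr ?(ltW mR0)// divff// gt_eqF.
have theta1 := theta_le1 m_gt0 theta_gt0 theta2.
apply/eqP; rewrite eq_le; apply/andP; split.
  (* Upper bound: as [theta <= 1], the set lies in the unit interval, which is null for every
     exponent [1 + e]. *)
  apply/lee_addgt0Pr => e e0; rewrite -EFinD.
  apply: ereal_inf_lbound; exists (1 + e) => //=; split; first lra.
  apply: hausdorff_measure_unit_itv; first lra.
  by move=> x [[]]; rewrite /= !in_itv /= => /andP[x0 xt] _ _; apply/andP; split; lra.
apply: le_ereal_inf_tmp => _ [s [s0 sE] <-]; rewrite lee_fin leNgt; apply/negP => s1.
by apply: (E_set_positive m_gt0 theta_gt0 theta2 _ eta_ge0 sE); rewrite s0.
Qed.
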